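(* Let $n\ge 1$ and let $A,B\in \mathrm{SGL}_n(\mathbb{F}_2)$ be such that $B-A=\sum_{i=1}^r \mathbf{x}_i\mathbf{x}_i^{\top}$ for some linearly independent column vectors $\mathbf{x}_1,\ldots,\mathbf{x}_r\in\mathbb{F}_2^n$ ($r\ge 1$). (i) If $\mathbf{x}_i^{\top}A^{-1}\mathbf{x}_i=1$ for all $i$, then $d(A,B)=r+2$ if $\mathbf{x}_i^{\top}A^{-1}\mathbf{x}_j=1$ for all $i,j$, and $d(A,B)=r+1$ otherwise. (ii) If the $r\times r$ matrix $[\mathbf{x}_i^{\top}A^{-1}\mathbf{x}_j]_{i,j=1}^r$ belongs to $\mathcal{R}_1^{\mathrm{Tr}_0}$, then $d(A,B)=r+2$. (iii) Otherwise (i.e. if neither the hypothesis of (i) nor that of (ii) holds), $d(A,B)=r$.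
   Context: $\mathbb{F}_2$ is the binary field. $\mathrm{SGL}_n(\mathbb{F}_2)$ is the set of invertible symmetric $n\times n$ matrices over $\mathbb{F}_2$. $\Gamma_n$ is the graph with vertex set $\mathrm{SGL}_n(\mathbb{F}_2)$ in which $A,B$ are adjacent iff $\mathrm{rank}(A-B)=1$; $d(A,B)$ denotes the graph distance in $\Gamma_n$. For a size $m$, $\mathcal{R}_1^{\mathrm{Tr}_0}$ denotes the set of symmetric $m\times m$ matrices over $\mathbb{F}_2$ of rank one and trace zero. *)

(* Defs.v *)
From mathcomp Require Import all_boot all_algebra.
Set Implicit Arguments. Unset Strict Implicit. Unset Printing Implicit Defensive.
Import GRing.Theory.
Local Open Scope ring_scope.

Notation F2 := 'F_2.

Definition SGL (n : nat) (A : 'M[F2]_n) : bool := (A^T == A) && (A \in unitmx).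

Definition adj (n : nat) (A B : 'M[F2]_n) : bool := \rank (A - B) == 1%N.

Definition walk_of_len (n : nat) (A B : 'M[F2]_n) (k : nat) : Prop :=
  exists s : seq 'M[F2]_n,
    [/\ size s = k, path (@adj n) A s, last A s = B & all (@SGL n) s].

Definition gdist_eq (n : nat) (A B : 'M[F2]_n) (k : nat) : Prop :=
  walk_of_len A B k /\ forall m, walk_of_len A B m -> (k <= m)%N.

Definition R1Tr0 (m : nat) (G : 'M[F2]_m) : bool :=
  [&& G^T == G, \rank G == 1%N & \tr G == 0].

Definition gram (n r : nat) (A : 'M[F2]_n) (x : 'I_r -> 'cV[F2]_n) : 'M[F2]_r :=
  \matrix_(i < r, j < r) ((x i)^T *m invmx A *m x j) 0 0.

(* Main.v *)
Require Import Defs.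
From mathcomp Require Import all_boot all_algebra.
Import GRing.Theory.
Local Open Scope ring_scope.
Set Implicit Arguments.
Unset Strict Implicit.
Unset Printing Implicit Defensive.

(** Put [X = (x_1 ... x_r)] and [G = X^T A^-1 X], so that [B = A + X X^T]. A walk
    of length [m] from [A] to [B] writes [X X^T] as [Y Y^T] with [Y] of size
    [n x m]; if [m <= r + 1] then [Y = X C] with [C C^T = 1]. If [G] has unit
    diagonal and [m = r], then [C] is orthogonal and already the first step is
    singular; if [G = u u^T], the first column [c] of [C] with [u^T c = 1] gives
    a singular step.

    Conversely a walk of length at most [r] exists as soon as [G] has a zero on
    the diagonal and is not of the form [u u^T], [u <> 0]. By induction it is
    enough to find an orthogonal change of the [x_i] and a pivot [i] with
    [G i i = 0] whose Schur complement has the same two properties; permutations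
    and the transvections along [e_o + e_i + e_j + e_k] suffice. The remaining
    cases reduce to this one: adjoin the zero column to [X], or first move
    to [A + z z^T] and adjoin the column [z]. *)

(** * Arithmetic over the binary field *)

Lemma F2_cases (a : 'F_2) : a = 0 \/ a = 1.
Proof. by case: a => [[|[|m]] //= lt_m]; [left | right]; apply: val_inj. Qed.

Lemma F2_neq0 (a : 'F_2) : a <> 0 -> a = 1.
Proof. by case: (F2_cases a). Qed.

Lemma F2_neq1 (a : 'F_2) : a <> 1 -> a = 0.
Proof. by case: (F2_cases a). Qed.

Lemma F2_sqr (a : 'F_2) : a * a = a.
Proof. by case: (F2_cases a) => ->; apply: val_inj. Qed.

Lemma F2_addrr (a : 'F_2) : a + a = 0.
Proof. by case: (F2_cases a) => ->; apply: val_inj. Qed.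

Lemma F2mx_addrr m n (A : 'M['F_2]_(m, n)) : A + A = 0.
Proof. by apply/matrixP => i j; rewrite !mxE F2_addrr. Qed.

Lemma F2mx_opp m n (A : 'M['F_2]_(m, n)) : - A = A.
Proof. by apply/esym/eqP; rewrite -addr_eq0 F2mx_addrr. Qed.

(** * Squares, good matrices and pivots *)

Definition is_square {r} (G : 'M['F_2]_r) : Prop :=
  exists2 u : 'cV['F_2]_r, u != 0 & G = u *m u^T.

(** The guard on [r] makes the empty matrix good, which ends the induction on the number of
    columns. *)
Definition good {r} (G : 'M['F_2]_r) : Prop :=
  ((0 < r)%N -> exists a, G a a = 0) /\ ~ is_square G.

(* Injectivity of [1 + G]; for a Gram matrix [X^T A^-1 X] this expresses that
   [A + X X^T] is invertible. *)
Definition add1_inj {r} (G : 'M['F_2]_r) : Prop :=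
  forall c : 'cV['F_2]_r, c + G *m c = 0 -> c = 0.

(** When [G i i = 0], adding the identity gives the usual Schur complement of [1 + G] at [i];
    [gram_schur] reads it as the Gram matrix left after one step. *)
Definition schur {r} (i : 'I_r.+1) (G : 'M['F_2]_r.+1) : 'M['F_2]_r :=
  \matrix_(a, b) (G (lift i a) (lift i b) + G (lift i a) i * G i (lift i b)).

(** [P] replaces [X] by [X P], which keeps [X X^T]; column [i] of [X P] is to be the first step of a
    walk. *)
Definition step_good {r} (G : 'M['F_2]_r.+1) : Prop :=
  exists P : 'M['F_2]_r.+1, exists i, [/\ P *m P^T = 1%:M,
    (P^T *m G *m P) i i = 0 & good (schur i (P^T *m G *m P))].

Lemma sym_entry r (G : 'M['F_2]_r) a b : G^T = G -> G a b = G b a.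
Proof. by move=> sG; rewrite -{1}sG mxE. Qed.

Lemma square_entry r (u : 'cV['F_2]_r) a b : (u *m u^T) a b = u a 0 * u b 0.
Proof. by rewrite mxE big_ord1 !mxE. Qed.

(* Over F_2 a square [u u^T] is determined by its diagonal, which is [u]. *)
Lemma not_square_entry r (G : 'M['F_2]_r) a b :
  G a b <> G a a * G b b -> ~ is_square G.
Proof. by move=> nG [u _ eG]; apply: nG; rewrite eG !square_entry !F2_sqr. Qed.

Lemma good_pivot r (G : 'M['F_2]_r.+1) (i : 'I_r.+1) (a : 'I_r.+1) :
  a != i -> G a a + G a i * G i a = 0 -> ~ is_square (schur i G) ->
  good (schur i G).
Proof.
case: (unliftP i a) => [a' -> _ h nsq | -> /eqP //].
by split => // _; exists a'; rewrite mxE.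
Qed.

Lemma not_square_schur r (G : 'M['F_2]_r.+1) (i a b : 'I_r.+1) :
  a != i -> b != i ->
  G a b + G a i * G i b <> (G a a + G a i * G i a) * (G b b + G b i * G i b) ->
  ~ is_square (schur i G).
Proof.
case: (unliftP i a) => [a' -> _ | -> /eqP //].
case: (unliftP i b) => [b' -> _ h | -> /eqP //].
by apply: (@not_square_entry _ _ a' b'); rewrite !mxE.
Qed.

Lemma step_good_pivot r (G : 'M['F_2]_r.+1) i :
  G i i = 0 -> good (schur i G) -> step_good G.
Proof. by move=> Gii gs; exists 1%:M, i; rewrite trmx1 !mul1mx mulmx1. Qed.

(** * Invariance under orthogonal changes of basis *)

Section Orthogonal.
Variables (r : nat) (P : 'M['F_2]_r.+1).
Hypothesis orthP : P *m P^T = 1%:M.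

Lemma orth_tr : P^T *m P = 1%:M. Proof. exact: mulmx1C. Qed.

Lemma sym_conj (G : 'M['F_2]_r.+1) :
  G^T = G -> (P^T *m G *m P)^T = P^T *m G *m P.
Proof. by move=> sG; rewrite !trmx_mul trmxK sG mulmxA. Qed.

Lemma add1_inj_conj (G : 'M['F_2]_r.+1) :
  add1_inj G -> add1_inj (P^T *m G *m P).
Proof.
move=> iG c hc; suff: P *m c = 0.
  by move=> /(congr1 (mulmx P^T)); rewrite mulmxA orth_tr mul1mx mulmx0.
apply: iG; move/(congr1 (mulmx P)): hc.
by rewrite mulmxDr mulmx0 !mulmxA orthP mul1mx.
Qed.

Lemma square_conj (G : 'M['F_2]_r.+1) :
  ~ is_square G -> ~ is_square (P^T *m G *m P).
Proof.
move=> nG [u u0 eG]; apply: nG; exists (P *m u).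
  apply: contraNneq u0 => /(congr1 (mulmx P^T)).
  by rewrite mulmxA orth_tr mul1mx mulmx0 => ->.
rewrite trmx_mul mulmxA -(mulmxA P) -eG !mulmxA orthP mul1mx.
by rewrite -mulmxA orthP mulmx1.
Qed.

Lemma step_good_conj (G : 'M['F_2]_r.+1) :
  step_good (P^T *m G *m P) -> step_good G.
Proof.
case=> Q [i [oQ h1 h2]]; exists (P *m Q), i.
have -> : (P *m Q)^T *m G *m (P *m Q) = Q^T *m (P^T *m G *m P) *m Q.
  by rewrite trmx_mul !mulmxA.
split=> //; rewrite trmx_mul mulmxA -(mulmxA P) oQ mulmx1; exact: orthP.
Qed.

End Orthogonal.

(** * Transvections along four basis vectors *)

Definition quad_vec r (o i j k : 'I_r.+1) : 'cV['F_2]_r.+1 :=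
  \col_a ((a == o)%:R + (a == i)%:R + (a == j)%:R + (a == k)%:R).

(* The transvection along [e_o + e_i + e_j + e_k] maps [e_k] to
   [e_o + e_i + e_j], and similarly for the other three indices. *)
Definition quad_mx r (o i j k : 'I_r.+1) : 'M['F_2]_r.+1 :=
  1%:M + quad_vec o i j k *m (quad_vec o i j k)^T.

Lemma quad_mx_tr r (o i j k : 'I_r.+1) : (quad_mx o i j k)^T = quad_mx o i j k.
Proof. by rewrite /quad_mx linearD /= trmx1 trmx_mul trmxK. Qed.

Lemma mulmx_quad r m (G : 'M['F_2]_(m, r.+1)) (o i j k : 'I_r.+1) a :
  (G *m quad_vec o i j k) a 0 = G a o + G a i + G a j + G a k.
Proof.
have sum1 (l : 'I_r.+1) : \sum_b G a b * (b == l)%:R = G a l.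
  rewrite (bigD1 l) //= eqxx mulr1 big1 ?addr0 // => b /negPf ->.
  by rewrite mulr0.
rewrite mxE; under eq_bigr do rewrite mxE !mulrDr.
by rewrite !big_split /= !sum1.
Qed.

Section Quad.
Variables (r : nat) (o i j k : 'I_r.+1).
Hypotheses (oi : o != i) (oj : o != j) (ok : o != k).
Hypotheses (ij : i != j) (ik : i != k) (jk : j != k).

Let w := quad_vec o i j k.

Lemma quad_vec1 a : a \in [:: o; i; j; k] -> w a 0 = 1.
Proof.
have neq := (negPf oi, negPf oj, negPf ok, negPf ij, negPf ik, negPf jk).
have sym := (eq_sym i o, eq_sym j o, eq_sym k o, eq_sym j i, eq_sym k i, eq_sym k j).
rewrite !inE mxE => /or4P[] /eqP ->; rewrite eqxx ?sym ?neq;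
  exact: val_inj.
Qed.

(** The vector [w] has four ones, so [w^T w = 0] and the symmetric matrix [1 + w w^T] squares to the
    identity. *)
Lemma quad_mx_orth : quad_mx o i j k *m (quad_mx o i j k)^T = 1%:M.
Proof.
have ww : w^T *m w = 0.
  apply/matrixP => a b; rewrite !ord1 mulmx_quad [RHS]mxE.
  have wT l : w^T 0 l = w l 0 by rewrite mxE.
  rewrite !wT !quad_vec1 ?inE ?eqxx ?orbT //; exact: val_inj.
rewrite quad_mx_tr /quad_mx -/w mulmxDl !mulmxDr !mul1mx mulmx1.
rewrite -mulmxA (mulmxA w^T) ww mul0mx mulmx0 addr0 -addrA.
by rewrite F2mx_addrr addr0.
Qed.

Lemma quad_conj_entry (G : 'M['F_2]_r.+1) a b : G^T = G ->
  a \in [:: o; i; j; k] -> b \in [:: o; i; j; k] ->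
  ((quad_mx o i j k)^T *m G *m quad_mx o i j k) a b =
  G a b + (G a o + G a i + G a j + G a k) + (G b o + G b i + G b j + G b k)
  + ((G o o + G o i + G o j + G o k) + (G i o + G i i + G i j + G i k)
  + (G j o + G j i + G j j + G j k) + (G k o + G k i + G k j + G k k)).
Proof.
move=> sG wa wb; rewrite quad_mx_tr /quad_mx -/w.
rewrite mulmxDl mul1mx mulmxDr mulmx1 mulmxDl.
have e1 : (G *m (w *m w^T)) a b = G a o + G a i + G a j + G a k.
  by rewrite mulmxA mxE big_ord1 mulmx_quad mxE quad_vec1 ?mulr1.
have e2 : (w *m w^T *m G) a b = G b o + G b i + G b j + G b k.
  rewrite -mulmxA -{1}sG -trmx_mul mxE big_ord1 quad_vec1 // mul1r.
  by rewrite mxE mulmx_quad.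
have e3 : (w *m w^T *m G *m (w *m w^T)) a b =
  (G o o + G o i + G o j + G o k) + (G i o + G i i + G i j + G i k)
  + (G j o + G j i + G j j + G j k) + (G k o + G k i + G k j + G k k).
  rewrite mulmxA mxE big_ord1 [w^T 0 b]mxE quad_vec1 // mulr1.
  rewrite -!mulmxA mxE big_ord1 quad_vec1 // mul1r.
  rewrite -[w^T *m _]trmxK [in LHS]mxE trmx_mul trmxK mulmx_quad.
  by rewrite ![(G *m w)^T _ _]mxE !mulmx_quad.
have addE (U V : 'M['F_2]_r.+1) : (U + V) a b = U a b + V a b by rewrite mxE.
by rewrite !addE addrA [X in X + _ = _]addrAC e1 e2 e3.
Qed.

End Quad.

(** * Pivots whose Schur complement is a square *)

(** The vector [e_i + t e_o] is nonzero, so its image under [1 + G] has a nonzero coordinate [l]. *)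
Lemma add1_inj_pair r (G : 'M['F_2]_r) i o t : add1_inj G -> i != o ->
  exists l, (l == i)%:R + t * (l == o)%:R + (G l i + t * G l o) <> 0.
Proof.
move=> iG nio; pose c : 'cV['F_2]_r := \col_a ((a == i)%:R + t * (a == o)%:R).
have Gc l : (G *m c) l 0 = G l i + t * G l o.
  rewrite mxE; under eq_bigr do rewrite mxE mulrDr.
  rewrite big_split /=; congr (_ + _).
    rewrite (bigD1 i) //= eqxx mulr1 big1 ?addr0 // => b /negPf ->.
    by rewrite mulr0.
  rewrite (bigD1 o) //= eqxx mulr1 mulrC big1 ?addr0 // => b /negPf ->.
  by rewrite !mulr0.
have [/forallP c0 | ] := boolP [forall l, (c + G *m c) l 0 == 0].
  have: c = 0.
    by apply: iG; apply/colP => l; rewrite (eqP (c0 l)) mxE.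
  move/colP/(_ i); rewrite !mxE eqxx (negPf nio) mulr0 addr0.
  by move/(congr1 val).
by case/forallPn => l /eqP; rewrite mxE Gc mxE; exists l.
Qed.

(* The case where the Schur complement at the pivot [o] is a square [U U^T]:
   another pivot, possibly after a transvection, is then found. *)
Section BadPivot.
Variables (r : nat) (G : 'M['F_2]_r.+1) (o : 'I_r.+1) (U : 'I_r.+1 -> 'F_2).
Hypotheses (symG : G^T = G) (injG : add1_inj G) (nsqG : ~ is_square G).
Hypotheses (Goo : G o o = 0) (Uo : U o = 0).
Hypothesis GE : forall a b, a != o -> b != o ->
  G a b = U a * U b + G a o * G b o.

(** [1 + G] maps [e_i + G_io e_o] to a vector that vanishes at [o] and [i] and equals [U] elsewhere,
    so injectivity yields a further one in [U]. *)
Lemma bad_pivot_weight i : i != o -> U i = 1 ->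
  exists a, [/\ a != o, a != i & U a = 1].
Proof.
move=> io Ui; have Goi := sym_entry o i symG.
have [l] := add1_inj_pair (G i o) injG io.
have [-> | lo] := eqVneq l o.
  rewrite eq_sym (negPf io) Goi Goo => h; case: h.
  by case: (F2_cases (G i o)) => ->; apply: val_inj.
have [-> | li] := eqVneq l i.
  rewrite (GE io io) Ui F2_sqr => h; case: h.
  by case: (F2_cases (G i o)) => ->; apply: val_inj.
move=> h; exists l; split=> //; apply: F2_neq0 => Ul; apply: h.
by rewrite (GE lo io) Ul mul0r !add0r mulr0 add0r mulrC F2_addrr.
Qed.

(** If column [o] vanished, [G] itself would be the square [U U^T]. *)
Lemma bad_pivot_row_neq0 i : U i = 1 -> exists2 k, k != o & G k o = 1.
Proof.
move=> Ui; have [/existsP[k /eqP Gko] | ] := boolP [exists k, G k o == 1].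
  by exists k => //; apply/eqP => ko; move: Gko; rewrite ko Goo => /(congr1 val).
move=> /existsPn Gk; have {}Gk k : G k o = 0 by apply: F2_neq1 => /eqP; apply/negP.
case: nsqG; exists (\col_a U a).
  apply/eqP => /colP/(_ i); rewrite !mxE Ui; by move/(congr1 val).
apply/matrixP => a b; rewrite square_entry !mxE.
have [-> | ao] := eqVneq a o; first by rewrite sym_entry // Gk Uo mul0r.
have [-> | bo] := eqVneq b o; first by rewrite Gk Uo mulr0.
by rewrite GE // Gk mul0r addr0.
Qed.

(** Column [i] of [G] is zero, so the Schur complement at [i] merely deletes row and column [i]; if
    it were a square, extending its vector by 0 would make [G] a square. *)
Lemma bad_pivot_step00 i : i != o -> U i = 0 -> G i o = 0 -> step_good G.
Proof.
move=> io Ui Gio; have Gi a : G a i = 0.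
  have [-> | ao] := eqVneq a o; first by rewrite sym_entry.
  by rewrite GE // Ui Gio !mulr0 addr0.
apply: (@step_good_pivot _ _ i); first exact: Gi.
apply: (@good_pivot _ _ _ o); rewrite 1?eq_sym // ?Gi ?Goo ?mul0r ?addr0 //.
move=> [t t0 eS]; apply: nsqG.
pose T a := if unlift i a is Some a' then t a' 0 else 0.
have TE a' : T (lift i a') = t a' 0 by rewrite /T liftK.
have Ti : T i = 0 by rewrite /T unlift_none.
exists (\col_a T a).
  apply: contra_neq t0 => /colP T0; apply/colP => a'.
  by rewrite -TE; move: (T0 (lift i a')); rewrite !mxE.
apply/matrixP => a b; rewrite square_entry !mxE.
case: (unliftP i a) => [a' -> | ->]; last by rewrite sym_entry // Gi Ti mul0r.
case: (unliftP i b) => [b' -> | ->]; last by rewrite Gi Ti mulr0.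
rewrite !TE -square_entry -eS mxE Gi mul0r addr0; by [].
Qed.

(** The pivot is [i]. With [a] another one of [U], the Schur complement has entry 0 at [(a, a)] but
    1 at [(o, a)], so it is no square. *)
Lemma bad_pivot_step11 i : i != o -> U i = 1 -> G i o = 1 -> step_good G.
Proof.
move=> io Ui Gio; have [a [ao ai Ua]] := bad_pivot_weight io Ui.
have Gai : G a i = 1 + G a o by rewrite GE // Ui Gio Ua !mulr1.
have Gaa : G a a = 1 + G a o by rewrite GE // Ua !F2_sqr.
have [Gia Goa Goi] : [/\ G i a = G a i, G o a = G a o & G o i = G i o].
  by split; apply: sym_entry.
apply: (@step_good_pivot _ _ i); first by rewrite GE // Ui Gio; apply: val_inj.
apply: (@good_pivot _ _ _ a) => //.
  by rewrite Gia Gaa Gai F2_sqr F2_addrr.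
apply: (@not_square_schur _ _ _ o a) => //; first by rewrite eq_sym.
rewrite Goa Goi Gia Gio Goo Gaa Gai.
by case: (F2_cases (G a o)) => -> /(congr1 val).
Qed.

(** Here [G a a = 1] for all [a <> o], so only [o] has a zero on the diagonal. With [i], [j] among
    the ones of [U] and [G k o = 1], the transvection turns [k] into a pivot. *)
Lemma bad_pivot_step01 i : i != o -> U i = 1 ->
  (forall a, a != o -> G a o = 1 + U a) -> step_good G.
Proof.
move=> io Ui GU; have [j [jo ji Uj]] := bad_pivot_weight io Ui.
have [k ko Gko] := bad_pivot_row_neq0 Ui.
have Uk : U k = 0 by move: Gko; rewrite GU //; case: (F2_cases (U k)) => -> // /(congr1 val).
have Gio : G i o = 0 by rewrite GU // Ui; apply: val_inj.
have Gjo : G j o = 0 by rewrite GU // Uj; apply: val_inj.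
have ik : i != k by apply/eqP => ik; move: Gko; rewrite -ik Gio => /(congr1 val).
have jk : j != k by apply/eqP => jk; move: Gko; rewrite -jk Gjo => /(congr1 val).
have E : ((G i i = 1) * (G j j = 1) * (G k k = 1) * (G j i = 1) * (G i j = 1)
  * (G i k = 0) * (G k i = 0) * (G j k = 0) * (G k j = 0) * (G o i = 0)
  * (G o j = 0) * (G o k = 1))%type.
  by do ! split; first [rewrite GE // ?Ui ?Uj ?Uk ?Gio ?Gjo ?Gko; apply: val_inj | by rewrite sym_entry].
have orth : quad_mx o i j k *m (quad_mx o i j k)^T = 1%:M.
  by apply: quad_mx_orth; rewrite // eq_sym.
have GQ a b := @quad_conj_entry _ o i j k _ _ _ _ _ _ G a b symG.
set H := (_ *m _) in GQ.
(* The final 1 is [w^T G w], the sum of the sixteen entries of [G] on [o], [i], [j], [k]. *)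
have HE a b : a \in [:: o; i; j; k] -> b \in [:: o; i; j; k] ->
  H a b = G a b + (G a o + G a i + G a j + G a k)
    + (G b o + G b i + G b j + G b k) + 1.
  move=> wa wb; rewrite GQ // 1?eq_sym // !E Goo Gio Gjo Gko.
  by congr (_ + _); apply: val_inj.
apply: (step_good_conj orth); apply: (@step_good_pivot _ _ k); rewrite -/H.
  by rewrite HE ?inE ?eqxx ?orbT // !E Gko; apply: val_inj.
have Hc : ((H o k = 1) * (H k o = 1) * (H o o = 1) * (H i k = 1) * (H k i = 1)
  * (H i i = 0) * (H o i = 0))%type.
  by do ! split; rewrite HE ?inE ?eqxx ?orbT // !E ?Gko ?Gio ?Goo; apply: val_inj.
apply: (@good_pivot _ _ _ o); first by rewrite eq_sym.
  by rewrite !Hc; apply: val_inj.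
apply: (@not_square_schur _ _ _ o i) => //; first by rewrite eq_sym.
by rewrite !Hc => /(congr1 val).
Qed.

(** An index with [G a o <> 1 + U a] has [(U a, G a o)] equal to [(0, 0)] or [(1, 1)]. *)
Lemma bad_pivot_step_aux i : i != o -> U i = 1 -> step_good G.
Proof.
move=> io Ui.
have [/forallP GU | ] := boolP [forall a, (a != o) ==> (G a o == 1 + U a)].
  by apply: (@bad_pivot_step01 i) => // a ao; apply/eqP; apply: (implyP (GU a)).
case/forallPn => a; rewrite negb_imply => /andP[ao].
case: (F2_cases (U a)) => Ua; case: (F2_cases (G a o)) => Ga; rewrite Ua Ga //.
  by move=> _; apply: (bad_pivot_step00 ao).
by move=> _; apply: (bad_pivot_step11 ao).
Qed.

End BadPivot.

Lemma bad_pivot_step r (G : 'M['F_2]_r.+1) o :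
  G^T = G -> add1_inj G -> ~ is_square G -> G o o = 0 ->
  is_square (schur o G) -> step_good G.
Proof.
move=> symG injG nsqG Goo [u u0 eS].
pose U a := if unlift o a is Some a' then u a' 0 else 0.
have UE a' : U (lift o a') = u a' 0 by rewrite /U liftK.
have GE a b : a != o -> b != o -> G a b = U a * U b + G a o * G b o.
  case: (unliftP o a) => [a' -> _ | -> /eqP //].
  case: (unliftP o b) => [b' -> _ | -> /eqP //].
  rewrite !UE -square_entry -eS mxE [G o _]sym_entry //.
  by rewrite -addrA F2_addrr addr0.
have [i ui] : exists i, u i 0 = 1.
  have [/existsP[i /eqP ?] | /existsPn nu] := boolP [exists i, u i 0 == 1].
    by exists i.
  case/eqP: u0; apply/colP => i; rewrite mxE.
  by apply: F2_neq1 => /eqP; apply/negP.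
apply: (bad_pivot_step_aux symG injG nsqG Goo _ GE (i := lift o i)).
- by rewrite /U unlift_none.
- by rewrite eq_sym neq_lift.
- by rewrite UE ui.
Qed.

(** * Existence of a pivot *)

Lemma pivot_step r (G : 'M['F_2]_r.+1) i a :
  G^T = G -> add1_inj G -> ~ is_square G -> G i i = 0 -> a != i ->
  G a a + G a i * G i a = 0 -> step_good G.
Proof.
move=> symG injG nsqG Gii ai Ga.
have [/existsP[u /andP[u0 /eqP eS]] | /existsPn nS] :=
  boolP [exists u : 'cV['F_2]_r, (u != 0) && (schur i G == u *m u^T)].
  by apply: (@bad_pivot_step _ _ i) => //; exists u.
apply: (step_good_pivot Gii); apply: (good_pivot ai) => // -[u u0 eS].
by move: (nS u); rewrite u0 eS eqxx.
Qed.

Lemma exists_step r (G : 'M['F_2]_r.+1) :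
  G^T = G -> add1_inj G -> good G -> step_good G.
Proof.
move=> symG injG [/(_ isT)[o Goo] nsqG].
case: r G symG injG nsqG o Goo => [|r] G symG injG nsqG o Goo.
  apply: (step_good_pivot Goo); split=> // -[u /eqP[]].
  by apply/colP => -[].
(* The pivot [o] is tried first: a zero on the diagonal of its Schur complement is enough. *)
have [/existsP[a /andP[ao /eqP Ga]] | /existsPn alt] :=
  boolP [exists a, (a != o) && (G a a + G a o * G o a == 0)].
  exact: (@pivot_step _ _ o a).
have {}alt a : a != o -> G a a = 1 + G a o.
  move=> ao; move: (alt a); rewrite ao /= [G o a]sym_entry // F2_sqr.
  by case: (F2_cases (G a a)) => ->; case: (F2_cases (G a o)) => -> // _; apply: val_inj.
(* Next a pivot [j] with [G j o = 1], for then [G j j = 0]. Injectivity at [e_j + e_o] yields [a]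
   with [G a j <> G a o], where the Schur complement at [j] has a zero. *)
have [/existsP[j /eqP Gjo] | /existsPn Gk] := boolP [exists k, G k o == 1].
  have jo : j != o by apply/eqP => jo; move: Gjo; rewrite jo Goo => /(congr1 val).
  have Gjj : G j j = 0 by rewrite alt // Gjo; apply: val_inj.
  have Goj : G o j = 1 by rewrite sym_entry.
  have [a] := add1_inj_pair (1) injG jo; rewrite !mul1r.
  have [-> | ao] := eqVneq a o.
    rewrite eq_sym (negPf jo) Goj Goo => h; case: h; exact: val_inj.
  have [-> | aj] := eqVneq a j.
    rewrite Gjo Gjj => h; case: h; exact: val_inj.
  move=> h; apply: (@pivot_step _ _ j a) => //.
  rewrite [G j a]sym_entry // F2_sqr alt //; move: h.
  by case: (F2_cases (G a j)) => ->; case: (F2_cases (G a o)) => -> h;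
     first [exact: val_inj | case: h; exact: val_inj].
have {}Gk k : G k o = 0 by apply: F2_neq1 => /eqP; apply/negP.
have {}alt a : a != o -> G a a = 1 by move=> ao; rewrite alt // Gk addr0.
(* Now [G] is 0 on row and column [o] and 1 on the rest of the diagonal; if it were 1 everywhere off
   [o], it would be a square. *)
have [i [j [io jo Gij]]] : exists i, exists j, [/\ i != o, j != o & G i j = 0].
  have [/existsP[i /existsP[j /and3P[io jo /eqP Gij]]] | /existsPn nij] :=
    boolP [exists i, exists j, [&& i != o, j != o & G i j == 0]].
    by exists i, j.
  case: nsqG; exists (\col_a (a != o)%:R).
    have [a ao] : exists a, a != o by exists (lift o ord0); rewrite eq_sym neq_lift.
    by apply/eqP => /colP/(_ a); rewrite !mxE ao => /(congr1 val).
  apply/matrixP => a b; rewrite square_entry !mxE.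
  have [-> | ao] := eqVneq a o; first by rewrite sym_entry // Gk mul0r.
  have [-> | bo] := eqVneq b o; first by rewrite Gk mulr0.
  rewrite mulr1; move: (nij a) => /existsPn/(_ b); rewrite ao bo /= => /eqP.
  exact: F2_neq0.
have ij : i != j by apply/eqP => ij; move: Gij; rewrite -ij alt // => /(congr1 val).
have Gji : G j i = 0 by rewrite sym_entry.
have Go a : G o a = 0 by rewrite sym_entry.
(* Injectivity at [e_i + e_j] gives [k] with [G k i <> G k j]. After the transvection [k] has
   diagonal entry 0, and its Schur complement has a zero at [o]. *)
have [k] := add1_inj_pair (1) injG ij; rewrite !mul1r.
have [-> | ki] := eqVneq k i.
  rewrite (negPf ij) alt // Gij => h; case: h; exact: val_inj.
have [-> | kj] := eqVneq k j.
  rewrite alt // Gji => h; case: h; exact: val_inj.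
have [-> | ko] := eqVneq k o.
  rewrite !Go => h; case: h; exact: val_inj.
move=> /F2_neq0; rewrite !add0r => Gkij.
have orth : quad_mx o i j k *m (quad_mx o i j k)^T = 1%:M.
  by apply: quad_mx_orth; rewrite // eq_sym.
have GQ a b := @quad_conj_entry _ o i j k _ _ _ _ _ _ G a b symG.
apply: (step_good_conj orth).
have [Gik Gjk] : G i k = G k i /\ G j k = G k j by split; apply: sym_entry.
have E := (alt _ io, alt _ jo, alt _ ko, Gk, Go, Gij, Gji, Gik, Gjk).
apply: (@pivot_step _ _ k o).
- exact: sym_conj.
- exact: add1_inj_conj.
- exact: square_conj.
- rewrite GQ ?inE ?eqxx ?orbT // 1?eq_sym // !E; move: Gkij.
  by case: (F2_cases (G k i)) => ->; case: (F2_cases (G k j)) => -> h;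
     first [exact: val_inj | move/(congr1 val): h].
- by rewrite eq_sym.
- rewrite !GQ ?inE ?eqxx ?orbT // 1?eq_sym // !E; move: Gkij.
  by case: (F2_cases (G k i)) => ->; case: (F2_cases (G k j)) => -> h;
     first [exact: val_inj | move/(congr1 val): h].
Qed.

(** * Symmetric matrices of rank one *)

Lemma mx1_cases (t : 'M['F_2]_1) : t = 0 \/ t = 1%:M.
Proof.
by rewrite [t]mx11_scalar; case: (F2_cases (t 0 0)) => ->; [left | right];
  rewrite // raddf0.
Qed.

Lemma rank_square n (y : 'cV['F_2]_n) : y != 0 -> \rank (y *m y^T) = 1%N.
Proof.
move=> y0; apply/eqP; rewrite eqn_leq mulmx_max_rank lt0n mxrank_eq0.
apply: contra_neq y0 => /matrixP yy; apply/colP => i.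
by move: (yy i i); rewrite square_entry F2_sqr !mxE.
Qed.

(** Write [D = c w] and pick an entry [D a b = 1]; symmetry read in column [b] forces [c = w^T]. *)
Lemma rank1_square n (D : 'M['F_2]_n) :
  D^T = D -> \rank D = 1%N -> is_square D.
Proof.
move=> symD rkD; have D0 : D != 0 by rewrite -mxrank_eq0 rkD.
have [c [w eD]] : exists c : 'cV['F_2]_n, exists w : 'rV_n, D = c *m w.
  by have := mulmx_base D; move: (col_base D) (row_base D); rewrite rkD
    => c w; exists c, w.
have De a b : D a b = c a 0 * w 0 b by rewrite eD mxE big_ord1.
have [a [b]] : exists a, exists b, D a b = 1.
  have [/existsP[a /existsP[b /eqP]] | nD] := boolP [exists a, exists b, D a b == 1].
    by exists a, b.
  case/eqP: D0; apply/matrixP => a b; rewrite mxE; apply: F2_neq1 => Dab.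
  by case/negP: nD; apply/existsP; exists a; apply/existsP; exists b; apply/eqP.
rewrite De => cw1; have sD x y : c x 0 * w 0 y = c y 0 * w 0 x.
  by rewrite -!De sym_entry.
have wb : w 0 b = 1.
  by case: (F2_cases (w 0 b)) cw1 => -> //; rewrite mulr0 => /(congr1 val).
have cb : c b 0 = 1.
  by move: cw1; rewrite sD; case: (F2_cases (c b 0)) => -> //;
     rewrite mul0r => /(congr1 val).
have cE x : c x 0 = w 0 x by rewrite -[LHS]mulr1 -wb sD cb mul1r.
exists c; last by rewrite eD; congr (_ *m _); apply/rowP => x; rewrite mxE cE.
by apply: contra_neq D0 => c0; rewrite eD c0 mul0mx.
Qed.

(** * Rank-one updates and Gram matrices *)

(** The nonzero vector [p], in the role of [S^-1 y], lies in the kernel of [S + y y^T]. *)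
Lemma unit_add_contra n (S : 'M['F_2]_n) (y p : 'cV['F_2]_n) :
  S *m p = y -> y^T *m p = 1%:M -> S + y *m y^T \in unitmx -> False.
Proof.
move=> Sp yp uS; have : (S + y *m y^T) *m p = 0.
  by rewrite mulmxDl Sp -mulmxA yp mulmx1 F2mx_addrr.
move/(congr1 (mulmx (invmx (S + y *m y^T)))); rewrite mulKmx // mulmx0 => p0.
by move: yp; rewrite p0 mulmx0 => /matrixP/(_ 0 0); rewrite !mxE => /(congr1 val).
Qed.

Lemma SGLP n (A : 'M['F_2]_n) : reflect (A^T = A /\ A \in unitmx) (SGL A).
Proof. by apply: (iffP andP) => -[/eqP]. Qed.

Lemma SGL_inv_sym n (A : 'M['F_2]_n) : SGL A -> (invmx A)^T = invmx A.
Proof. by case/SGLP => sA _; rewrite trmx_inv sA. Qed.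

Lemma gram_sym n r (A : 'M['F_2]_n) (X : 'M_(n, r)) : SGL A ->
  (X^T *m invmx A *m X)^T = X^T *m invmx A *m X.
Proof. by move=> sA; rewrite !trmx_mul trmxK SGL_inv_sym // mulmxA. Qed.

(** The Sherman-Morrison formula, with denominator [1 + y^T A^-1 y = 1]. *)
Lemma invmx_add_square n (A : 'M['F_2]_n) (y : 'cV['F_2]_n) :
  SGL A -> y^T *m invmx A *m y = 0 ->
  SGL (A + y *m y^T) /\
  invmx (A + y *m y^T) = invmx A + invmx A *m y *m (y^T *m invmx A).
Proof.
move=> /SGLP[sA uA] y0.
have AQ : (A + y *m y^T) *m (invmx A + invmx A *m y *m (y^T *m invmx A)) = 1%:M.
  rewrite mulmxDl !mulmxDr mulmxV // !mulmxA mulmxV // mul1mx.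
  have -> : y *m y^T *m invmx A *m y = y *m (y^T *m invmx A *m y).
    by rewrite !mulmxA.
  by rewrite y0 mulmx0 !mul0mx addr0 -addrA F2mx_addrr addr0.
have [uAy _] := mulmx1_unit AQ; split.
  by apply/SGLP; split=> //; rewrite linearD /= sA trmx_mul trmxK.
by rewrite -[LHS]mulmx1 -AQ mulKmx.
Qed.

Lemma col_mulmx m n p (A : 'M['F_2]_(m, n)) (B : 'M_(n, p)) j :
  col j (A *m B) = A *m col j B.
Proof. by rewrite !colE mulmxA. Qed.

Lemma gram_entry n r s (K : 'M['F_2]_n) (X : 'M_(n, r)) (Z : 'M_(n, s)) a b :
  (X^T *m K *m Z) a b = ((col a X)^T *m K *m col b Z) 0 0.
Proof. by rewrite tr_col -row_mul !mxE; apply: eq_bigr => l _; rewrite !mxE. Qed.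

Lemma gram_add_square n r s (A : 'M['F_2]_n) (X : 'M_(n, r)) (Z : 'M_(n, s))
    (y : 'cV_n) : SGL A -> y^T *m invmx A *m y = 0 ->
  X^T *m invmx (A + y *m y^T) *m Z =
  X^T *m invmx A *m Z + (X^T *m invmx A *m y) *m (y^T *m invmx A *m Z).
Proof.
move=> sA y0; have [_ ->] := invmx_add_square sA y0.
by rewrite mulmxDr mulmxDl !mulmxA.
Qed.

Lemma gram_schur n r (A : 'M['F_2]_n) (Y : 'M_(n, r.+1)) (i : 'I_r.+1) :
  SGL A -> (Y^T *m invmx A *m Y) i i = 0 ->
  SGL (A + col i Y *m (col i Y)^T) /\
  (col' i Y)^T *m invmx (A + col i Y *m (col i Y)^T) *m col' i Y =
  schur i (Y^T *m invmx A *m Y).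
Proof.
move=> sA Yii; have y0 : (col i Y)^T *m invmx A *m col i Y = 0.
  by apply/matrixP => a b; rewrite !ord1 -gram_entry Yii mxE.
split; first by case: (invmx_add_square sA y0).
rewrite gram_add_square //; apply/matrixP => a b.
have colE c : col c (col' i Y) = col (lift i c) Y by apply/colP => d; rewrite !mxE.
have c0 (v : 'cV['F_2]_n) : col 0 v = v by apply/colP => d; rewrite !mxE.
rewrite [LHS]mxE [X in _ + X]mxE big_ord1 [RHS]mxE.
rewrite !(gram_entry _ (col' i Y)) !(gram_entry _ (col i Y) (col' i Y)).
by rewrite !(gram_entry _ Y) !colE !c0.
Qed.

Lemma mulmx_tr_pivot n r (Y : 'M['F_2]_(n, r.+1)) (i : 'I_r.+1) :
  Y *m Y^T = col i Y *m (col i Y)^T + col' i Y *m (col' i Y)^T.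
Proof.
apply/matrixP => a b; rewrite [RHS]mxE square_entry !mxE (bigD1_ord i) //= !mxE.
by congr (_ + _); apply: eq_bigr => l _; rewrite !mxE.
Qed.

(** Since [(A + X X^T) A^-1 X c = X (c + G c)], the equation [c + G c = 0] gives [A^-1 X c = 0],
    hence [G c = 0] and [c = 0]. *)
Lemma gram_add1_inj n r (A : 'M['F_2]_n) (X : 'M_(n, r)) :
  SGL A -> SGL (A + X *m X^T) -> add1_inj (X^T *m invmx A *m X).
Proof.
move=> /SGLP[_ uA] /SGLP[_ uB] c hc.
have: (A + X *m X^T) *m (invmx A *m X *m c) = 0.
  rewrite mulmxDl !mulmxA mulmxV // mul1mx -!mulmxA -mulmxDr.
  by move: hc; rewrite -!mulmxA => ->; rewrite mulmx0.
move/(congr1 (mulmx (invmx (A + X *m X^T)))); rewrite mulKmx // mulmx0 => h.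
by move: hc; rewrite -!mulmxA (mulmxA (invmx A)) h mulmx0 addr0.
Qed.

(** * Walks and sums of squares *)

Lemma walk_cons n (A C B : 'M['F_2]_n) k :
  adj A C -> SGL C -> walk_of_len C B k -> walk_of_len A B k.+1.
Proof.
move=> aAC sC [s [sz ps ls als]]; exists (C :: s).
by split=> //=; rewrite ?sz ?aAC ?sC.
Qed.

(** Lengths are bounded rather than fixed because a zero column contributes no step. *)
Definition walk_le n (A B : 'M['F_2]_n) (m : nat) : Prop :=
  exists2 k, (k <= m)%N & walk_of_len A B k.

Lemma walk_le_step n (A B : 'M['F_2]_n) (y : 'cV_n) m :
  SGL (A + y *m y^T) -> walk_le (A + y *m y^T) B m -> walk_le A B m.+1.
Proof.
move=> sAy [k km wk]; have [y0 | y0] := eqVneq y 0.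
  by exists k; [exact: leqW | move: wk; rewrite y0 mul0mx addr0].
exists k.+1 => //; apply: walk_cons wk => //.
by rewrite /adj opprD addrA subrr add0r F2mx_opp rank_square.
Qed.

(** Induction on [r]: the pivot column of [X P] is the first step, and the Schur complement is the
    good Gram matrix of the other columns. *)
Lemma walk_le_good n r (A : 'M['F_2]_n) (X : 'M_(n, r)) :
  SGL A -> SGL (A + X *m X^T) -> good (X^T *m invmx A *m X) ->
  walk_le A (A + X *m X^T) r.
Proof.
elim: r A X => [|r IH] A X sA sB gG.
  exists 0%N => //; exists [::]; split=> //=.
  have -> : X = 0 by apply/matrixP => a [].
  by rewrite mul0mx addr0.
have [P [i [oP Pii gP]]] := exists_step (gram_sym X sA) (gram_add1_inj sA sB) gG.
have eG : P^T *m (X^T *m invmx A *m X) *m P = (X *m P)^T *m invmx A *m (X *m P).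
  by rewrite trmx_mul !mulmxA.
rewrite eG in Pii gP; set Y := X *m P in Pii gP.
have [sAy eS] := gram_schur sA Pii.
have eX : A + X *m X^T = A + col i Y *m (col i Y)^T + col' i Y *m (col' i Y)^T.
  rewrite -addrA -mulmx_tr_pivot /Y trmx_mul mulmxA -(mulmxA X).
  by rewrite oP mulmx1.
apply: (walk_le_step sAy); rewrite eX in sB *.
by apply: (IH _ _ sAy sB); rewrite eS.
Qed.

(** Each edge difference is symmetric of rank one, hence some [y y^T]. Indexing by [nat] lets one
    family serve every prefix of the walk. *)
Lemma walk_vectors n (A B : 'M['F_2]_n) m : SGL A -> walk_of_len A B m ->
  exists y : nat -> 'cV['F_2]_n, B = A + \sum_(i < m) y i *m (y i)^T /\
    forall k, (k <= m)%N -> SGL (A + \sum_(i < k) y i *m (y i)^T).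
Proof.
elim: m A => [|m IH] A sA [[|C s] [] //= sz].
  move=> _ <- _; exists (fun _ => 0); split=> [|[] //=]; by rewrite big_ord0 addr0.
case/andP => aAC ps ls /andP[sC als]; case: sz => sz.
have [|y [eB yk]] := IH C sC; first by exists s.
have [y0 _ eC] : is_square (C - A).
  apply: rank1_square; last by rewrite -mxrank_opp opprB; apply/eqP.
  by case/SGLP: sA => sA _; case/SGLP: sC => sC' _; rewrite linearB /= sA sC'.
have {}eC : C = A + y0 *m y0^T by rewrite -eC addrC subrK.
exists (fun i => if i is i'.+1 then y i' else y0); split.
  by rewrite big_ord_recl addrA -eC.
case=> [|k km]; first by rewrite big_ord0 addr0.
by rewrite big_ord_recl addrA -eC; apply: yk.
Qed.

(** * Two factorisations of the same matrix *)

Lemma mulmx_tr_sum n r (X : 'M['F_2]_(n, r)) :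
  X *m X^T = \sum_i col i X *m (col i X)^T.
Proof.
apply/matrixP => a b; rewrite mxE summxE; apply: eq_bigr => i _.
by rewrite square_entry !mxE.
Qed.

Section EqualSquares.
Variables (n r m : nat) (X : 'M['F_2]_(n, r)) (Y : 'M['F_2]_(n, m)).
Hypotheses (freeX : row_free X^T) (eXY : Y *m Y^T = X *m X^T).

Let fullX : row_full X.
Proof. by rewrite /row_full -mxrank_tr; exact: freeX. Qed.

Lemma eq_squares_sub : (X^T <= Y^T)%MS.
Proof. by rewrite -(eqmxMfull X^T fullX) -eXY submxMl. Qed.

Lemma eq_squares_leq : (r <= m)%N.
Proof.
by rewrite -(eqP freeX) (leq_trans (mxrankS eq_squares_sub)) // rank_leq_row.
Qed.

(** If [Y] had rank above [r], its at most [r + 1] columns would be independent and [Y Y^T] would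
    have that rank too, whereas [X X^T] has rank [r]. So [Y = X C], and a left inverse of [X]
    cancels [X] on both sides. *)
Lemma eq_squares_factor : (m <= r.+1)%N ->
  exists2 C : 'M['F_2]_(r, m), Y = X *m C & C *m C^T = 1%:M.
Proof.
move=> mr; have rkY : \rank Y^T = r.
  apply/eqP; rewrite eqn_leq; apply/andP; split; last first.
    by rewrite -(eqP freeX) mxrankS // eq_squares_sub.
  rewrite leqNgt; apply/negP => rY.
  have freeY : row_free Y^T.
    by rewrite /row_free eqn_leq rank_leq_row (leq_trans mr).
  have fullY : row_full Y by rewrite /row_full -mxrank_tr; exact: freeY.
  move: rY; rewrite -(eqmxMfull Y^T fullY) eXY (eqmxMfull X^T fullX).
  by rewrite (eqP freeX) ltnn.
have /submxP[D eD] : (Y^T <= X^T)%MS.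
  by rewrite -(mxrank_leqif_sup eq_squares_sub).2 rkY (eqP freeX).
have eY : Y = X *m D^T by rewrite -[Y]trmxK eD trmx_mul trmxK.
exists D^T => //.
have [L LX] : exists L, L *m X = 1%:M by exists (pinvmx X); apply: mulVpmx.
have XL : X^T *m L^T = 1%:M by rewrite -trmx_mul LX trmx1.
rewrite -[LHS]mul1mx -[LHS]mulmx1 -{1}LX -XL.
have -> : L *m X *m (D^T *m D^T^T) *m (X^T *m L^T) = L *m (Y *m Y^T) *m L^T.
  by rewrite eY trmx_mul !mulmxA.
by rewrite eXY mulmxA LX mul1mx XL.
Qed.

End EqualSquares.

(** * Lower bounds on the length of a walk *)

Section LowerBounds.
Variables (n r : nat) (A B : 'M['F_2]_n) (X : 'M['F_2]_(n, r)).
Hypotheses (sA : SGL A) (freeX : row_free X^T) (eB : B = A + X *m X^T).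

Lemma walk_vectors_mx m : walk_of_len A B m ->
  exists2 Y : 'M['F_2]_(n, m), Y *m Y^T = X *m X^T &
    forall j : 'I_m, A + \sum_(i < m | (i < j)%N) col i Y *m (col i Y)^T
      + col j Y *m (col j Y)^T \in unitmx.
Proof.
case/(walk_vectors sA) => y [eBy yk]; pose Y : 'M['F_2]_(n, m) := \matrix_(a, i) y i a 0.
have cY i : col i Y = y i by apply/colP => a; rewrite !mxE.
exists Y.
  apply: (@addrI _ A); rewrite -eB eBy mulmx_tr_sum.
  by congr (_ + _); apply: eq_bigr => i _; rewrite cY.
move=> j; have /SGLP[_] := yk j.+1 (ltn_ord j).
rewrite big_ord_recr /= addrA cY.
rewrite (big_ord_widen m (fun i => y i *m (y i)^T) (ltnW (ltn_ord j))).
by under [in X in _ -> X]eq_bigr do rewrite cY.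
Qed.

Lemma walk_geq m : walk_of_len A B m -> (r <= m)%N.
Proof. by case/walk_vectors_mx => Y eY _; apply: eq_squares_leq eY. Qed.

(** In length [r] the factor [C] is square and orthogonal, so its first column has [c^T c = 1]. As
    [1 + G] is alternating, [c^T G c = c^T c = 1], and the first step is singular. *)
Lemma walk_geq_alternating m : (0 < r)%N ->
  (forall i, (X^T *m invmx A *m X) i i = 1) ->
  walk_of_len A B m -> (r < m)%N.
Proof.
move=> r0 G1 wm; rewrite ltn_neqAle walk_geq // andbT.
apply/eqP => rm; move: wm; rewrite -{m}rm => /walk_vectors_mx[Y eY uY].
have [C YC oC] := eq_squares_factor freeX eY (leqnSn r).
have symG := gram_sym X sA; pose o := Ordinal r0.
have [G eG] : exists G, G = X^T *m invmx A *m X by eexists.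
rewrite -eG in G1 symG.
(* The strict upper triangle of [G] exhibits [1 + G] as [T + T^T]. *)
pose T : 'M['F_2]_r := \matrix_(a, b) (if (a < b)%N then G a b else 0).
have GT : G = 1%:M + (T + T^T).
  apply/matrixP => a b; rewrite !mxE; case: (ltngtP a b) => ab.
  - by rewrite -val_eqE /= (ltn_eqF ab) addr0 add0r.
  - by rewrite -val_eqE /= (gtn_eqF ab) !add0r sym_entry.
  - by rewrite (val_inj ab) eqxx G1 !addr0.
have cc : (col o C)^T *m col o C = 1%:M.
  apply/matrixP => a b; rewrite !ord1 -[X in _ *m X]mul1mx mulmxA -gram_entry.
  by rewrite mulmx1 (mulmx1C oC) !mxE !eqxx.
apply: (@unit_add_contra _ A (col o Y) (invmx A *m col o Y)).
- by case/SGLP: sA => _ uA; rewrite mulKVmx.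
- rewrite YC col_mulmx trmx_mul.
  have -> : (col o C)^T *m X^T *m (invmx A *m (X *m col o C)) =
            (col o C)^T *m G *m col o C by rewrite eG !mulmxA.
  rewrite GT mulmxDr mulmxDl mulmx1 cc mulmxDr mulmxDl.
  have tr1 (t : 'M['F_2]_1) : t^T = t by apply/matrixP => a b; rewrite !ord1 mxE.
  by rewrite -[X in _ + (_ + X)]tr1 !trmx_mul !trmxK mulmxA F2mx_addrr addr0.
- by move: (uY o); rewrite big_pred0_eq addr0.
Qed.

(** In length at most [r + 1], [u^T C] vanishes column by column: if [u^T] kills the columns before
    [c_j], then [A^-1 y_j] is still a preimage of [y_j] under the current matrix, and [u^T c_j = 1]
    would make step [j] singular. Then [C C^T = 1] forces [u = 0]. *)
Lemma walk_geq_square m : is_square (X^T *m invmx A *m X) ->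
  walk_of_len A B m -> (r.+1 < m)%N.
Proof.
case=> u u0 eG /walk_vectors_mx[Y eY uY].
rewrite ltnNge; apply/negP => mr.
have [C YC oC] := eq_squares_factor freeX eY mr.
have yy i j : (col i Y)^T *m (invmx A *m col j Y) =
    (u^T *m col i C)^T *m (u^T *m col j C).
  rewrite YC !col_mulmx !trmx_mul trmxK !mulmxA -(mulmxA _ u) -eG.
  by rewrite !mulmxA.
have uC (j : 'I_m) : u^T *m col j C = 0.
  have [k] := ubnP (val j); elim: k j => // k IH j jk.
  have [// | uj] := mx1_cases (u^T *m col j C).
  case: (@unit_add_contra _ _ (col j Y) (invmx A *m col j Y) _ _ (uY j)).
    case/SGLP: sA => _ uA; rewrite mulmxDl mulKVmx // mulmx_suml big1 ?addr0 //.
    move=> i ij; rewrite -mulmxA yy IH ?trmx0 ?mul0mx ?mulmx0 //.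
    exact: leq_trans ij _.
  by rewrite yy uj trmx1 mulmx1.
case/eqP: u0; apply: trmx_inj; rewrite trmx0 -[LHS]mulmx1 -oC mulmxA.
suff -> : u^T *m C = 0 by rewrite mul0mx.
by apply/matrixP => a j; move/colP/(_ a): (uC j); rewrite -col_mulmx !mxE.
Qed.

End LowerBounds.

(** * Upper bounds by explicit walks *)

Section UpperBounds.
Variables (n r : nat) (A : 'M['F_2]_n) (X : 'M['F_2]_(n, r)).
Hypotheses (sA : SGL A) (sB : SGL (A + X *m X^T)).
Let G := X^T *m invmx A *m X.

(* Adjoining a zero column lets orthogonal changes of basis of size [r + 1]
   act, at the cost of one step. *)
Lemma walk_le_alternating : (forall i, G i i = 1) ->
  ~ (forall i j, G i j = 1) -> walk_le A (A + X *m X^T) r.+1.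
Proof.
move=> G1 nG; pose X0 := row_mx X (0 : 'cV['F_2]_n).
have eX : X0 *m X0^T = X *m X^T by rewrite tr_row_mx mul_row_col mul0mx addr0.
have eG : X0^T *m invmx A *m X0 = block_mx G 0 0 0.
  by rewrite tr_row_mx mul_col_mx mul_col_row !mulmx0 trmx0 !mul0mx.
rewrite -[r.+1]addn1 -eX; apply: (walk_le_good sA); first by rewrite eX.
rewrite eG; split=> [_ | [u _ eu]].
  by exists (rshift r 0); rewrite block_mxEdr mxE.
apply: nG => i j.
have uE a b : G a b = u (lshift 1 a) 0 * u (lshift 1 b) 0.
  by rewrite -square_entry -eu block_mxEul.
by move: (G1 i) (G1 j); rewrite !uE !F2_sqr => -> ->; rewrite mulr1.
Qed.

(** Step to [A + z z^T] with [z^T A^-1 z = 0] and [X^T A^-1 z <> 0], then adjoin [z] to [X]. The new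
    Gram matrix has a zero corner below a nonzero column, so it is good. *)
Lemma walk_le_square : row_free X^T -> is_square G ->
  walk_le A (A + X *m X^T) r.+2.
Proof.
move=> freeX [u u0 eG]; have injG := gram_add1_inj sA sB.
case/SGLP: (sA) => symA uA.
(* For [r = 1] one has [G = 1], and [A + X X^T] would be singular. *)
have [i [j ij]] : exists i : 'I_r, exists j : 'I_r, i != j.
  have [i ui] : exists i, u i 0 != 0.
    by apply/existsP; rewrite -negb_forall; apply: contra u0 => /forallP u0;
       apply/eqP/colP => a; rewrite mxE; apply/eqP.
  have [/existsP[j ij] | /existsPn all_i] := boolP [exists j, i != j].
    by exists i, j.
  have u1 : u = const_mx 1.
    apply/colP => a; rewrite mxE; move: (all_i a); rewrite negbK => /eqP <-.
    exact/F2_neq0/eqP.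
  move: u0; rewrite [u]injG ?eqxx // -/G eG -mulmxA.
  suff -> : u^T *m u = 1%:M by rewrite mulmx1 F2mx_addrr.
  apply/matrixP => a b; rewrite !ord1 [LHS]mxE (bigD1 i) //= big1 => [|c]; last first.
    by move: (all_i c); rewrite negbK eq_sym => ->.
  by rewrite u1 !mxE; apply: val_inj.
have psi_surj (c : 'cV['F_2]_r) : exists z, X^T *m invmx A *m z = c.
  exists (A *m (pinvmx X^T *m c)).
  by rewrite mulmxA mulmxKV // mulmxA mulmxVp // mul1mx.
(* Over F_2 the form [z^T A^-1 z] is additive in [z], so it vanishes on a preimage of [e_i], of
   [e_j], or on the sum of the two. *)
have [z z0 psi_z] : exists2 z : 'cV['F_2]_n,
    z^T *m invmx A *m z = 0 & X^T *m invmx A *m z != 0.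
  have [y ey] := psi_surj (delta_mx i 0).
  have [z ez] := psi_surj (delta_mx j 0).
  have d0 (a : 'I_r) : delta_mx a 0 != 0 :> 'cV['F_2]_r.
    by apply/eqP => /colP/(_ a); rewrite !mxE !eqxx => /(congr1 val).
  have [y0 | y1] := mx1_cases (y^T *m invmx A *m y).
    by exists y => //; rewrite ey.
  have [z0 | z1] := mx1_cases (z^T *m invmx A *m z).
    by exists z => //; rewrite ez.
  exists (y + z).
    have zy : z^T *m invmx A *m y = y^T *m invmx A *m z.
      have tr1 (t : 'M['F_2]_1) : t = t^T by apply/matrixP => a b; rewrite !ord1 mxE.
      by rewrite [LHS]tr1 !trmx_mul trmxK SGL_inv_sym // mulmxA.
    rewrite [(y + z)^T]linearD /= !mulmxDl !mulmxDr y1 z1 zy.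
    by rewrite [X in _ + X]addrC F2mx_addrr.
  rewrite mulmxDr ey ez; apply/eqP => /colP/(_ i).
  by rewrite !mxE !eqxx (negPf ij) /= => /(congr1 val).
have [sAz _] := invmx_add_square sA z0.
apply: (walk_le_step sAz); pose Z := row_mx X z.
have eB : A + X *m X^T = A + z *m z^T + Z *m Z^T.
  rewrite /Z tr_row_mx mul_row_col -addrA; congr (_ + _).
  by rewrite addrCA F2mx_addrr addr0.
rewrite eB -[r.+1]addn1; apply: (walk_le_good sAz); first by rewrite -eB.
set H := _ *m Z.
have eH : H = block_mx (G + (X^T *m invmx A *m z) *m (z^T *m invmx A *m X))
    (X^T *m invmx A *m z) (z^T *m invmx A *m X) 0.
  rewrite /H /Z tr_row_mx mul_col_mx mul_col_row !(gram_add_square _ _ sA z0) z0.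
  by rewrite !mulmx0 !mul0mx !addr0.
split=> [_ | [t _ et]].
  by exists (rshift r 0); rewrite eH block_mxEdr mxE.
case/eqP: psi_z; apply/colP => a; rewrite [RHS]mxE.
have <- : H (lshift 1 a) (rshift r 0) = (X^T *m invmx A *m z) a 0.
  by rewrite eH block_mxEur.
have : H (rshift r 0) (rshift r 0) = 0 by rewrite eH block_mxEdr mxE.
by rewrite et !square_entry F2_sqr => ->; rewrite mulr0.
Qed.

End UpperBounds.

(** * The distance formula *)

Lemma walk_le_gdist n (A B : 'M['F_2]_n) k : walk_le A B k ->
  (forall m, walk_of_len A B m -> (k <= m)%N) -> gdist_eq A B k.
Proof.
case=> l lk wl lb; suff -> : k = l by split=> // m /lb; apply: leq_trans.
by apply/eqP; rewrite eqn_leq lk lb.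
Qed.

Theorem theorem2p1 (n r : nat) (A B : 'M['F_2]_n) (x : 'I_r -> 'cV['F_2]_n) :
  (0 < n)%N -> (0 < r)%N ->
  SGL A -> SGL B ->
  row_free (\matrix_(i < r) (x i)^T) ->
  B - A = \sum_(i < r) x i *m (x i)^T ->
  [/\ (forall i, gram A x i i = 1) ->
        ((forall i j, gram A x i j = 1) -> gdist_eq A B r.+2) /\
        (~ (forall i j, gram A x i j = 1) -> gdist_eq A B r.+1),
      R1Tr0 (gram A x) -> gdist_eq A B r.+2
    & ~ (forall i, gram A x i i = 1) -> ~~ R1Tr0 (gram A x) -> gdist_eq A B r].
Proof.
move=> _ r0 sA sB freeX eBA; pose X : 'M['F_2]_(n, r) := \matrix_(a, i) x i a 0.
have cX i : col i X = x i by apply/colP => a; rewrite !mxE.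
have eXT : \matrix_(i < r) (x i)^T = X^T by apply/matrixP => a b; rewrite !mxE.
have eG : gram A x = X^T *m invmx A *m X.
  by apply/matrixP => a b; rewrite gram_entry !cX mxE.
have eB : B = A + X *m X^T.
  rewrite -(subrK A B) eBA addrC mulmx_tr_sum.
  by congr (_ + _); apply: eq_bigr => i _; rewrite cX.
rewrite eXT in freeX; rewrite eG; set G := X^T *m invmx A *m X.
have sB' := sB; rewrite eB in sB'.
(* The all-ones matrix and the members of [R1Tr0] are both squares, so one distance computation
   serves both. *)
have square_dist : is_square G -> gdist_eq A B r.+2.
  move=> sqG; apply: walk_le_gdist => [|m].
    by rewrite eB; apply: walk_le_square.
  exact: (walk_geq_square sA freeX eB).
split.
- move=> G1; split=> nG.
    apply: square_dist; exists (const_mx 1).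
      by apply/eqP => /colP/(_ (Ordinal r0)); rewrite !mxE => /(congr1 val).
    by apply/matrixP => a b; rewrite square_entry nG !mxE mulr1.
  apply: walk_le_gdist => [|m]; first by rewrite eB; apply: walk_le_alternating.
  exact: (walk_geq_alternating sA freeX eB).
- by case/and3P => /eqP symG /eqP rkG _; apply: square_dist; apply: rank1_square.
- move=> nG1 nG; apply: walk_le_gdist => [|m]; last exact: (walk_geq sA freeX eB).
  (* A square [G] would have rank one and trace [u^T u = 0], and so would lie in [R1Tr0]. *)
  rewrite eB; apply: walk_le_good => //; rewrite -/G; split=> [_ | [u u0 eu]].
    have [/existsP[a /eqP Ga] | /existsPn nGa] := boolP [exists a, G a a == 0].
      by exists a.
    by case: nG1 => a; apply: F2_neq0 => /eqP; apply/negP.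
  case/negP: nG; rewrite /R1Tr0 gram_sym // eqxx eu rank_square // eqxx /=.
  rewrite mxtrace_mulC trace_mx11.
  (* [(1 + u u^T) u = (1 + u^T u) u], so [u^T u = 1] would make [B] singular. *)
  have [-> | uu] := mx1_cases (u^T *m u); first by rewrite mxE.
  by case/eqP: u0; apply: (gram_add1_inj sA sB'); rewrite -/G eu -mulmxA uu
    mulmx1 F2mx_addrr.
Qed.
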